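(* Let $N\ge 1$ be an integer, $T>0$, $\alpha\in(0,1)$, $\sigma>0$, $\nu,\mu\in\mathbb{R}$ with $\mu>\nu$, and $\rho_1,\dots,\rho_N\in\mathbb{R}$. Assume that either $$\gamma\in(0,1)\quad\text{and}\quad \max_{i=1,\dots,N}\rho_i\le\alpha\Big(\nu+\frac{(\mu-\nu)^2}{2\gamma\sigma^2}\Big),$$ or $$\gamma\in[1-\alpha,1).$$ Let $(\theta_1,\dots,\theta_N)$ be the (unique) positive solution on $[0,T]$ of $$ \begin{cases} \dot{\theta}_i(t)+(1-\gamma)\theta_i(t)\Big[\nu+\frac{(\mu-\nu)^2}{2\gamma\sigma^2}-\Big(\sum_{j=1}^N\theta_j(t)\Big)^{\frac{1}{\alpha-1}}\sum_{k=1}^N\theta_k(t)^{\frac{1-\gamma-\alpha}{(1-\alpha)(1-\gamma)}}\Big]\\ \quad-(1-\gamma)\rho_i\alpha^{-1}\theta_i(t)+\alpha^{-1}(1-\gamma)\theta_i(t)^{\frac{1-\gamma-\alpha}{(1-\alpha)(1-\gamma)}}\Big(\sum_{j=1}^N\theta_j(t)\Big)^{\frac{\alpha}{\alpha-1}}=0,\\ \theta_i(T)=1,\qquad i=1,\dots,N. \end{cases} $$ Let $\bar\pi=(\bar\pi_1,\dots,\bar\pi_N)\in(L^\infty_+(0,T))^N$ satisfy $\sum_{i=1}^N\bar\pi_i(t)=\frac{\mu-\nu}{\gamma\sigma^2}$ for $t\in[0,T]$, and let $\bar c=(\bar c_1,\dots,\bar c_N)$ be given by $$\bar c_i(t)=\Big(\sum_{j=1}^N\theta_j(t)\Big)^{\frac{1}{\alpha-1}}\theta_i(t)^{\frac{1-\gamma-\alpha}{(1-\alpha)(1-\gamma)}},\qquad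 t\in[0,T],\ i=1,\dots,N.$$ Then $(\bar\pi,\bar c)$ is an equilibrium Pareto investment-consumption strategy of the coalition.
   Context: $L^\infty_+(0,T)$ is the set of essentially bounded functions $\varphi:[0,T]\to[0,+\infty)$. $W$ is a one-dimensional standard Brownian motion and $\mathbb{E}_s$ is conditional expectation given the Brownian filtration at time $s$. A positive solution of the ODE system is one with $\theta_i(t)>0$ for all $t\in[0,T]$ and all $i$. Wealth. For a strategy $(\pi,c)\in(L^\infty_+(0,T))^N\times(L^\infty_+(0,T))^N$, with $\pi=(\pi_1,\dots,\pi_N)$, $c=(c_1,\dots,c_N)$, and initial data $(t,x)$, $x>0$, the wealth $X$ solves $$dX(s)=\Big[\nu X(s)+(\mu-\nu)\sum_{i=1}^N \pi_i(s)X(s)-\sum_{i=1}^N c_i(s)X(s)\Big]ds+\sigma\sum_{i=1}^N\pi_i(s)X(s)\,dW(s),\quad s\in[t,T],\qquad X(t)=x.$$ Utilities. Agent $i$'s utility is $J_i(t,x;\pi,c)=Y_i(t)$, where $Y_i$ solves $$Y_i(s)=\mathbb{E}_s\Big[\int_s^T g_i\big(c_i(r)X(r),Y_i(r)\big)dr+h_i(X(T))\Big],\quad s\in[t,T],$$ $$g_i(q,y)=\alpha^{-1}\big((1-\gamma)y\big)^{1-\frac{\alpha}{1-\gamma}}\Big[q^\alpha-\rho_i\big((1-\gamma)y\big)^{\frac{\alpha}{1-\gamma}}\Big],\qquad h_i(x)=\frac{x^{1-\gamma}}{1-\gamma}.$$ Convention: $Y_i$ always denotes the Markovian solution $Y_i(s)=\frac{\vartheta_i(s)}{1-\gamma}X(s)^{1-\gamma}$,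 where $\vartheta_i$ is the unique positive solution on $[0,T]$ of $$\dot{\vartheta}_i+(1-\gamma)\vartheta_i\Big[(\mu-\nu)\sum_{j}\pi_j-\sum_{j} c_j+\nu-\tfrac{\gamma\sigma^2}{2}\big(\sum_{j}\pi_j\big)^2-\tfrac{\rho_i}{\alpha}\Big]+\alpha^{-1}(1-\gamma)\vartheta_i^{\frac{1-\gamma-\alpha}{1-\gamma}}c_i^\alpha=0,\quad \vartheta_i(T)=1.$$ The coalition's objective is $J^\lambda(t,x;\pi,c)=\frac1N\sum_{i=1}^N J_i(t,x;\pi,c)$. Equilibrium. A pair $(\bar\pi,\bar c)\in(L^\infty_+(0,T))^N\times(L^\infty_+(0,T))^N$ is an equilibrium Pareto investment-consumption strategy (EPICS) of the coalition if, with $\bar X$ the wealth process under $(\bar\pi,\bar c)$ (started at time $0$ from a positive initial wealth), $$\limsup_{\varepsilon\to0^+}\frac{J^\lambda(t,\bar X(t);\bar\pi^\varepsilon,\bar c^\varepsilon)-J^\lambda(t,\bar X(t);\bar\pi,\bar c)}{\varepsilon}\le 0$$ for any $t\in[0,T)$ and any $(\pi,c)\in(L^\infty_+(0,T))^N\times(L^\infty_+(0,T))^N$, where for each $i$: $\bar\pi_i^\varepsilon(s)=\pi_i(s)$, $\bar c_i^\varepsilon(s)=c_i(s)$ for $s\in[t,t+\varepsilon)$, and $\bar\pi_i^\varepsilon(s)=\bar\pi_i(s)$, $\bar c_i^\varepsilon(s)=\bar c_i(s)$ for $s\in[t+\varepsilon,T]$. *)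

(* Defs.v *)
From HB Require Import structures.
From mathcomp Require Import all_boot all_order all_algebra.
From mathcomp Require Import all_classical all_reals all_analysis.
Import Order.TTheory GRing.Theory Num.Theory.
Import numFieldNormedType.Exports.

Set Implicit Arguments.
Unset Strict Implicit.
Unset Printing Implicit Defensive.

Local Open Scope classical_set_scope.
Local Open Scope ring_scope.

Section brownian.
Context {d : measure_display} {Omega : measurableType d} {R : realType}.
Context (P : probability Omega R).

(* The sigma-algebra generated by [W u], [0 <= u <= s], and the null events:
   the Brownian filtration augmented in the usual way. *)
Definition brownian_filtration (W : R -> Omega -> R) (s : R) :
    set (set Omega) :=
  <<s [set A | (exists (u : R) (B : set R), [/\ 0 <= u <= s, measurable B & A = W u @^-1` B])
            \/ (measurable A /\ P A = 0%E)] >>.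

Definition increment (W : R -> Omega -> R) (u v : R) (w : Omega) : R :=
  W v w - W u w.

(* [W s] is relevant for [0 <= s] only. *)
Definition brownian_motion (W : R -> Omega -> R) : Prop :=
  [/\ forall s : R, 0 <= s -> measurable_fun setT (W s),
      (\forall w \ae P, W 0 w = 0),
      (\forall w \ae P, {within `[0, +oo[, continuous (W ^~ w)}),
      (forall (u v : R) (B : set R), 0 <= u -> u < v -> measurable B ->
         P (increment W u v @^-1` B) = normal_prob 0 (Num.sqrt (v - u)) B) &
      (forall (u v : R) (A : set Omega) (B : set R), 0 <= u -> u < v ->
         brownian_filtration W u A -> measurable B ->
         P (A `&` increment W u v @^-1` B) =
           (P A * P (increment W u v @^-1` B))%E)].

Definition measurable_wrt (F : set (set Omega)) (Z : Omega -> R) : Prop :=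
  forall B : set R, measurable B -> F (Z @^-1` B).

(* [Y] is a version of the conditional expectation of [Z] given [F]. *)
Definition is_cond_exp (F : set (set Omega)) (Z Y : Omega -> R) : Prop :=
  [/\ P.-integrable setT (EFin \o Z), P.-integrable setT (EFin \o Y),
      measurable_wrt F Y &
      forall A, F A ->
        (\int[P]_(w in A) (Y w)%:E = \int[P]_(w in A) (Z w)%:E)%E].

Definition cvg_in_probability (Z : nat -> Omega -> R) (Zlim : Omega -> R) :
    Prop :=
  forall e : R, 0 < e ->
    (fun n => P [set w | e <= `|Z n w - Zlim w|]) @ \oo --> 0%E.

(* The process [\sum_(k < n) xi_k * 1_(]t_k, t_(k+1)])]. *)
Record step_process := StepProcess {
  step_size : nat ;
  step_node : nat -> R ;
  step_coef : nat -> Omega -> R }.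

Definition step_eval (H : step_process) (r : R) (w : Omega) : R :=
  \sum_(k < step_size H)
     step_coef H k w * \1_(`]step_node H k, step_node H k.+1]) r.

Definition step_integral (W : R -> Omega -> R) (H : step_process)
    (s : R) (w : Omega) : R :=
  \sum_(k < step_size H) step_coef H k w *
    (W (Num.min (step_node H k.+1) s) w - W (Num.min (step_node H k) s) w).

Definition elementary (W : R -> Omega -> R) (t T : R) (H : step_process) :
    Prop :=
  [/\ step_node H 0 = t, step_node H (step_size H) = T,
      (forall k, (k < step_size H)%N -> step_node H k <= step_node H k.+1) &
      (forall k, (k < step_size H)%N ->
         measurable_wrt (brownian_filtration W (step_node H k))
                        (step_coef H k) /\
         exists M : R, forall w, `|step_coef H k w| <= M)].

(* [I s] is the Ito integral of [H] over [[t, s]], [t <= s <= T]: elementary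
   processes tend to [H] in L^2(dr) in probability, and their integrals tend
   to [I] in probability. *)
Definition is_ito_integral (W : R -> Omega -> R) (t T : R)
    (H I : R -> Omega -> R) : Prop :=
  exists Hn : nat -> step_process,
    [/\ forall n, elementary W t T (Hn n),
        forall s : R, t <= s <= T -> measurable_fun setT (I s),
        cvg_in_probability
          (fun n w => \int[lebesgue_measure]_(r in `[t, T])
                         (step_eval (Hn n) r w - H r w) ^+ 2)
          (fun=> 0) &
        forall s : R, t <= s <= T ->
          cvg_in_probability (fun n => step_integral W (Hn n) s) (I s)].

End brownian.

Section model.
Context {d : measure_display} {Omega : measurableType d} {R : realType}.
Context (P : probability Omega R) (W : R -> Omega -> R).
Context (N : nat) (T nu mu sigma gamma alpha : R) (rho : 'I_N -> R).

Definition Linfty_plus (phi : R -> R) : Prop :=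
  [/\ measurable_fun `[0, T] phi,
      (forall s : R, 0 <= s <= T -> 0 <= phi s) &
      exists M : R,
        \forall s \ae lebesgue_measure, 0 <= s <= T -> phi s <= M].

(* Values of a strategy off [[0, T]] are irrelevant. *)
Definition strategy := 'I_N -> R -> R.

Definition admissible (p : strategy) : Prop := forall i, Linfty_plus (p i).

(* [X s] is relevant for [t <= s <= T] only. Positivity is automatic for the
   solution of this linear equation started at [x > 0]; it is recorded since
   the utilities are defined for positive wealth only. *)
Definition is_wealth (t x : R) (p c : strategy) (X : R -> Omega -> R) : Prop :=
  [/\ forall s : R, t <= s <= T ->
        measurable_wrt (brownian_filtration P W s) (X s),
      forall w, {within `[t, T], continuous (X ^~ w)},
      forall (s : R) w, t <= s <= T -> 0 < X s w,
      (\forall w \ae P, X t w = x) &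
      exists2 I : R -> Omega -> R,
        is_ito_integral P W t T
          (fun r w => sigma * (\sum_i p i r * X r w)) I &
        forall s : R, t <= s <= T -> \forall w \ae P,
          X s w = x
            + \int[lebesgue_measure]_(r in `[t, s])
                (nu * X r w + (mu - nu) * (\sum_i p i r * X r w)
                 - \sum_i c i r * X r w)
            + I s w].

Definition aggregator (i : 'I_N) (q y : R) : R :=
  alpha^-1 * ((1 - gamma) * y) `^ (1 - alpha / (1 - gamma)) *
  (q `^ alpha - rho i * ((1 - gamma) * y) `^ (alpha / (1 - gamma))).

Definition bequest (x : R) : R := x `^ (1 - gamma) / (1 - gamma).

(* Right-hand side of the equation of [vtheta_i], written as
   [vtheta' + utility_drift = 0]. *)
Definition utility_drift (p c : strategy) (i : 'I_N) (r v : R) : R :=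
  (1 - gamma) * v *
    ((mu - nu) * (\sum_j p j r) - \sum_j c j r + nu
     - gamma * sigma ^+ 2 / 2 * (\sum_j p j r) ^+ 2 - rho i / alpha)
  + alpha^-1 * (1 - gamma) *
    v `^ ((1 - gamma - alpha) / (1 - gamma)) * c i r `^ alpha.

(* The coefficients are only measurable and bounded, so the equation with its
   terminal condition is understood in the Caratheodory sense, that is, in
   integrated form. *)
Definition is_vtheta (p c : strategy) (i : 'I_N) (v : R -> R) : Prop :=
  [/\ {within `[0, T], continuous v},
      forall s : R, 0 <= s <= T -> 0 < v s &
      forall s : R, 0 <= s <= T ->
        v s = 1 + \int[lebesgue_measure]_(r in `[s, T])
                     utility_drift p c i r (v r)].

Definition solves_recursion (t : R) (c : strategy) (i : 'I_N)
    (X Y : R -> Omega -> R) : Prop :=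
  forall s : R, t <= s <= T ->
    is_cond_exp P (brownian_filtration P W s)
      (fun w => \int[lebesgue_measure]_(r in `[s, T])
                   aggregator i (c i r * X r w) (Y r w)
                + bequest (X T w))
      (Y s).

(* [Y] is the Markovian solution of the recursion of agent [i] along [X]. *)
Definition is_markovian_utility (t : R) (p c : strategy) (i : 'I_N)
    (X Y : R -> Omega -> R) : Prop :=
  solves_recursion t c i X Y /\
  exists2 v : R -> R, is_vtheta p c i v &
    forall (s : R) w, t <= s <= T ->
      Y s w = v s / (1 - gamma) * X s w `^ (1 - gamma).

(* [J i t x p c] is agent [i]'s utility [Y_i(t)], for all admissible data;
   this determines [J] there, as the positive [vtheta_i] is unique. *)
Definition is_utility (J : 'I_N -> R -> R -> strategy -> strategy -> R) :
    Prop :=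
  forall i (t x : R) p c, 0 <= t <= T -> 0 < x -> admissible p -> admissible c ->
    exists X Y : R -> Omega -> R,
      [/\ is_wealth t x p c X, is_markovian_utility t p c i X Y &
          \forall w \ae P, Y t w = J i t x p c].

Definition coalition_utility
    (J : 'I_N -> R -> R -> strategy -> strategy -> R)
    (t x : R) (p c : strategy) : R :=
  N%:R^-1 * \sum_i J i t x p c.

Definition perturb (t e : R) (p q : strategy) : strategy :=
  fun i s => if t <= s < t + e then p i s else q i s.

Definition EPICS (J : 'I_N -> R -> R -> strategy -> strategy -> R)
    (pbar cbar : strategy) : Prop :=
  [/\ admissible pbar, admissible cbar &
  forall (x0 : R) (Xbar : R -> Omega -> R), 0 < x0 ->
    is_wealth 0 x0 pbar cbar Xbar ->
  forall (t : R) (p c : strategy), 0 <= t < T ->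
    admissible p -> admissible c ->
  \forall w \ae P,
    (limf_esup (fun e : R =>
       ((coalition_utility J t (Xbar t w) (perturb t e p pbar)
                                          (perturb t e c cbar)
         - coalition_utility J t (Xbar t w) pbar cbar) / e)%:E)
      0^'+ <= 0)%E].

(* Classical solution on [[0, T]]: continuous up to the endpoints, with the
   equation holding in the interior; the one-sided derivatives at [0] and [T]
   then follow. *)
Definition is_theta (theta : 'I_N -> R -> R) : Prop :=
  [/\ forall i, {within `[0, T], continuous (theta i)},
      forall i (t : R), 0 <= t <= T -> 0 < theta i t,
      forall i, theta i T = 1 &
      forall i (t : R), 0 < t < T ->
        derivable (theta i) t 1 /\
        derive1 (theta i) t
        + (1 - gamma) * theta i t *
          (nu + (mu - nu) ^+ 2 / (2 * gamma * sigma ^+ 2)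
           - (\sum_j theta j t) `^ (1 / (alpha - 1)) *
             \sum_k theta k t `^
               ((1 - gamma - alpha) / ((1 - alpha) * (1 - gamma))))
        - (1 - gamma) * rho i * alpha^-1 * theta i t
        + alpha^-1 * (1 - gamma) *
          theta i t `^
            ((1 - gamma - alpha) / ((1 - alpha) * (1 - gamma))) *
          (\sum_j theta j t) `^ (alpha / (alpha - 1)) = 0].

End model.

(* Main.v *)
Require Import Defs.
From HB Require Import structures.
From mathcomp Require Import all_boot all_order all_algebra.
From mathcomp Require Import all_classical all_reals all_analysis.
From mathcomp Require Import measurable_realfun ring lra.
Import Order.TTheory GRing.Theory Num.Theory.
Import numFieldNormedType.Exports.

Set Implicit Arguments.
Unset Strict Implicit.

Local Open Scope classical_set_scope.
Local Open Scope ring_scope.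

(** Along any admissible strategy the utility of agent [i] from wealth [x] is
    [v t / (1 - gamma) * x `^ (1 - gamma)], where [v] is a positive solution of
    the backward scalar equation of [vtheta_i] ([utility_value]); a single
    sample point is enough to read this off.  All randomness thereby disappears
    and the equilibrium property becomes a statement on perturbed scalar
    equations.

    The system for [theta] is the family of these scalar equations written for
    the candidate strategy itself ([theta_is_vtheta]), and positive solutions
    are unique ([vtheta_unique]), so the candidate's utilities are governed by
    [theta].  When the strategy is changed on [[t, t + e)] only, the new
    solutions [v_i] still equal [theta_i] at [t + e], and by an a priori bound
    they stay within [O(e)] of it on [[t, t + e]]
    ([vtheta_near_terminal]).  Since the drift is Lipschitz on compact subsets
    of the positive half-line, replacing [v_i] by [theta_i] inside the drift
    costs only [O(e ^ 2)] after integration ([perturbed_vtheta_gain]).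

    What remains is the integral over [[t, t + e]] of the difference of the
    total drifts, both evaluated at [theta].  The candidate maximizes the total
    drift pointwise ([utility_drift_le_pareto]): the investment part is a concave
    quadratic in the sum of the [pi_j], with vertex [(mu - nu) / (gamma sigma^2)],
    and the consumption part is a sum of concave functions of one [c_i] each,
    whose first-order conditions give the formula of the candidate.  So the total
    gain is at most [C * e ^ 2] ([perturbed_total_gain]), and the difference
    quotient at most a constant times [e]. *)

#[local] Instance lebesgue_ae_filter (R : realType) :
  Filter (nbhs (almost_everywhere (@lebesgue_measure R))).
Proof. exact: ae_filter_ringOfSetsType. Qed.

(** * Essentially bounded integrands *)

Lemma ae_bounded_integrable (R : realType) (a b K : R) (f : R -> R) :
  measurable_fun `[a, b] f ->
  (\forall r \ae lebesgue_measure, a <= r <= b -> `|f r| <= K) ->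
  (@lebesgue_measure R).-integrable `[a, b] (EFin \o f).
Proof.
move=> mf fK; apply/integrableP; split; first exact/measurable_EFinP.
apply: (@le_lt_trans _ _ ((`|K|)%:E * lebesgue_measure `[a, b]%classic)%E).
  apply: integral_le_bound => //.
  - exact/measurable_EFinP.
  - apply: filterS fK => r fr; rewrite /= in_itv/= => /fr {}fr.
    by rewrite lee_fin (le_trans fr)// ler_norm.
by rewrite lebesgue_measure_itv/=; case: ifP => _;
  rewrite ?mule0// -EFinD -EFinM ltry.
Qed.

(** The bound holds almost everywhere only, so the integral of [K - f] is that
    of its positive part. *)
Lemma Rintegral_ae_le (R : realType) (a b K : R) (f : R -> R) : a <= b ->
  (@lebesgue_measure R).-integrable `[a, b] (EFin \o f) ->
  (\forall r \ae lebesgue_measure, a <= r <= b -> f r <= K) ->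
  \int[lebesgue_measure]_(r in `[a, b]) f r <= K * (b - a).
Proof.
move=> ab intf fK.
have intK : (@lebesgue_measure R).-integrable `[a, b] (EFin \o cst K).
  by apply: (@ae_bounded_integrable _ _ _ `|K|) => //; apply: aeW.
have mKf : measurable_fun `[a, b] (fun r => K - f r).
  apply: measurable_funB => //.
  by apply/measurable_EFinP; exact: (measurable_int lebesgue_measure).
have <- : \int[lebesgue_measure]_(r in `[a, b]) K = K * (b - a).
  rewrite Rintegral_cst//; rewrite /= lebesgue_measure_itv/= lte_fin -EFinD.
  by case: ltgtP ab => //= -> _; rewrite subrr.
rewrite -subr_ge0 -RintegralB//.
have -> : \int[lebesgue_measure]_(r in `[a, b]) (K - f r) =
    \int[lebesgue_measure]_(r in `[a, b]) Num.max (K - f r) 0.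
  congr fine; apply: ae_eq_integral => //.
  - exact/measurable_EFinP.
  - by apply/measurable_EFinP; apply: measurable_maxr.
  - apply: filterS fK => r fr; rewrite /= in_itv/= => /fr {}fr.
    by congr EFin; case: leP => //; lra.
by apply: Rintegral_ge0 => r _; rewrite le_max lexx orbT.
Qed.

Lemma normr_Rintegral_ae_le (R : realType) (a b K : R) (f : R -> R) : a <= b ->
  (@lebesgue_measure R).-integrable `[a, b] (EFin \o f) ->
  (\forall r \ae lebesgue_measure, a <= r <= b -> `|f r| <= K) ->
  `|\int[lebesgue_measure]_(r in `[a, b]) f r| <= K * (b - a).
Proof.
move=> ab intf fK; apply: le_trans (le_normr_Rintegral _ intf) _ => //.
apply: Rintegral_ae_le => //; exact: integrable_norm.
Qed.

Lemma Rintegral_itv_cat (R : realType) (a b c : R) (f : R -> R) :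
  a <= b -> b <= c ->
  (@lebesgue_measure R).-integrable `[a, c] (EFin \o f) ->
  \int[lebesgue_measure]_(r in `[a, c]) f r =
  \int[lebesgue_measure]_(r in `[a, b]) f r +
  \int[lebesgue_measure]_(r in `[b, c]) f r.
Proof.
move=> ab bc intf.
have /eqP := @Rintegral_itvB R f (BLeft a) (BRight c) b intf
  (ltac:(by rewrite bnd_simp)) (ltac:(by rewrite bnd_simp)).
rewrite subr_eq addrC => /eqP ->; congr (_ + _).
rewrite Rintegral_itv_obnd_cbnd//.
by apply: integrableS intf => //; apply: subset_itvr; rewrite bnd_simp.
Qed.

Lemma integrable_itvB (R : realType) (a b : R) (f g : R -> R) :
  (@lebesgue_measure R).-integrable `[a, b] (EFin \o f) ->
  (@lebesgue_measure R).-integrable `[a, b] (EFin \o g) ->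
  (@lebesgue_measure R).-integrable `[a, b] (EFin \o (fun r => f r - g r)).
Proof.
move=> intf intg.
have -> : EFin \o (fun r => f r - g r) = ((EFin \o f) \- (EFin \o g))%E.
  by apply/funext.
exact: integrableB.
Qed.

Lemma integrable_itv_sum (R : realType) (I : Type) (s : seq I) (a b : R)
    (f : I -> R -> R) :
  (forall i, (@lebesgue_measure R).-integrable `[a, b] (EFin \o f i)) ->
  (@lebesgue_measure R).-integrable `[a, b]
    (EFin \o (fun r => \sum_(i <- s) f i r)).
Proof.
move=> intf; have -> : EFin \o (fun r => \sum_(i <- s) f i r) =
    (fun r => (\sum_(i <- s) (EFin \o f i) r)%E).
  by apply/funext => r /=; rewrite sumEFin.
exact: integrable_sum.
Qed.

Lemma Rintegral_itv_sum (R : realType) (I : Type) (s : seq I) (a b : R)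
    (f : I -> R -> R) :
  (forall i, (@lebesgue_measure R).-integrable `[a, b] (EFin \o f i)) ->
  \int[lebesgue_measure]_(r in `[a, b]) (\sum_(i <- s) f i r) =
  \sum_(i <- s) \int[lebesgue_measure]_(r in `[a, b]) f i r.
Proof.
move=> intf; elim: s => [|i s IH].
  under eq_Rintegral do rewrite big_nil.
  by rewrite big_nil Rintegral_cst// mul0r.
under eq_Rintegral do rewrite big_cons.
rewrite big_cons -IH RintegralD//; exact: integrable_itv_sum.
Qed.

Lemma lebesgue_ae_neq (R : realType) (a : R) :
  \forall r \ae (@lebesgue_measure R), r != a.
Proof.
exists [set a]; split; [exact: measurable_set1|exact: lebesgue_measure_set1|].
by move=> x /= /negP; rewrite negbK => /eqP.
Qed.

(** * Real powers *)

(** Concavity of the logarithm, applied to the convex combination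
    [a * (x / z) + (1 - a) * z^-1 = 1] with [z = 1 + a * (x - 1)]. *)
Lemma powR_le_tangent (R : realType) (a x : R) : 0 < a < 1 -> 0 <= x ->
  x `^ a <= 1 + a * (x - 1).
Proof.
move=> /andP[a0 a1]; rewrite le_eqVlt => /predU1P[<-|x0].
  by rewrite powR0 ?gt_eqF//; lra.
set z := 1 + _.
have z0 : 0 < z by rewrite /z; nra.
rewrite -ler_ln ?posrE ?powR_gt0// ln_powR.
have h (y : R) : 0 < y -> ln y <= y - 1.
  by move=> y0; have := @le_ln1Dx R (y - 1); rewrite [1 + _]addrC subrK; apply; lra.
have := h _ (divr_gt0 x0 z0); have := h z^-1; rewrite invr_gt0 => /(_ z0).
rewrite ln_div ?posrE// lnV ?posrE// => h1 h2.
have : (1 - a) * (z^-1 - 1) + a * (x / z - 1) = 0.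
  have -> : (1 - a) * (z^-1 - 1) + a * (x / z - 1) = z / z - 1.
    by rewrite {3}/z; ring.
  by rewrite divff ?subrr// gt_eqF.
nra.
Qed.

(** A real power is monotone, increasing or decreasing according to the sign of
    its exponent; adding the two endpoint values avoids the case distinction in
    every later use. *)
Lemma powR_segment_le (R : realType) (m M x s : R) : 0 < m -> m <= x <= M ->
  x `^ s <= m `^ s + M `^ s.
Proof.
move=> m0 /andP[mx xM]; have [s0|s0] := leP 0 s.
  by rewrite ler_wpDl ?powR_ge0// ge0_ler_powR// nnegrE; lra.
rewrite ler_wpDr ?powR_ge0//.
rewrite -[s]opprK !(powRN _ (- s)) lef_pV2 ?posrE ?powR_gt0//; last by lra.
by apply: ge0_ler_powR => //; rewrite ?nnegrE; lra.
Qed.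

Lemma powR_segment_lipschitz (R : realType) (m M s : R) : 0 < m ->
  exists2 L : R, 0 <= L & forall x y : R, m <= x <= M -> m <= y <= M ->
    `|x `^ s - y `^ s| <= L * `|x - y|.
Proof.
move=> m0; exists (`|s| * (m `^ (s - 1) + M `^ (s - 1))).
  by rewrite mulr_ge0// addr_ge0 ?powR_ge0.
move=> x y hx hy; wlog yx : x y hx hy / y <= x.
  move=> H; have [|xy] := leP y x; first exact: H.
  by rewrite distrC [X in _ <= _ * X]distrC; apply: H => //; exact: ltW.
have [z|z|z zxy ->] := @MVT_segment R (@powR R ^~ s) (fun z => s * z `^ (s - 1)) y x yx.
- by rewrite in_itv/= => /andP[yz zx]; apply: is_derive1_powR; lra.
- move: z; apply: continuous_in_subspaceT => z; rewrite inE/= in_itv/= => /andP[yz zx].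
  apply: differentiable_continuous; apply/derivable1_diffP.
  by apply: derivable_powR; rewrite in_itv/= andbT; lra.
move: zxy; rewrite in_itv/= => /andP[yz zx].
rewrite !normrM ler_wpM2r// ler_wpM2l// ger0_norm ?powR_ge0//.
by apply: powR_segment_le => //; lra.
Qed.

(** * Backward differential inequalities *)

(** A Gronwall uniqueness principle.  On a step shorter than [1 / (2 L)] the
    maximum of [|h|] is at most half of itself as soon as [h] vanishes at the
    right end, so [h] vanishes step by step down to [a].  The hypothesis is what
    an integral equation with an essentially [L]-Lipschitz integrand provides. *)
Lemma gronwall_zero (R : realType) (a b L : R) (h : R -> R) : 0 <= L ->
  {within `[a, b], continuous h} -> h b = 0 ->
  (forall s s' M : R, a <= s -> s <= s' -> s' <= b ->
     (forall r, s <= r <= s' -> `|h r| <= M) ->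
     `|h s - h s'| <= L * M * (s' - s)) ->
  forall s, a <= s <= b -> h s = 0.
Proof.
move=> L0 ch hb hL.
pose delta := (2 * (L + 1))^-1.
have d0 : 0 < delta by rewrite invr_gt0; lra.
have Ld : L * delta <= 2^-1.
  by rewrite /delta invfM mulrCA ler_piMr// ler_pdivrMr; lra.
suff H n s : a <= s <= b -> b - n%:R * delta <= s -> h s = 0.
  move=> s hs; have [n hn] : exists n : nat, (b - a) / delta < n%:R.
    by exists (Num.truncn ((b - a) / delta)).+1; exact: truncnS_gt.
  apply: (H n) => //; move: hn; rewrite ltr_pdivrMr//; lra.
elim: n s => [|n IH] s /andP[as_ sb].
  by rewrite mul0r subr0 => bs; rewrite (_ : s = b)//; lra.
move=> hs; pose s' := Num.min b (s + delta).
have hs' : [/\ s <= s', s' <= b, s' - s <= delta & h s' = 0].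
  have h1 : s <= s' by rewrite le_min sb/=; lra.
  have h2 : s' <= b by rewrite ge_min lexx.
  have h3 : s' <= s + delta by rewrite ge_min lexx orbT.
  split => //; first by lra.
  apply: IH; first by apply/andP; split => //; lra.
  have nd : 0 <= n%:R * delta by rewrite mulr_ge0// ltW.
  move: hs; rewrite -natr1 mulrDl mul1r => hs.
  by rewrite le_min; apply/andP; split; lra.
have [ss' s'b s'd hs'0] := hs'.
have [x] : exists2 c, c \in `[s, s']%R &
    forall t, t \in `[s, s']%R -> `|h t| <= `|h c|.
  apply: EVT_max => //; apply: (@continuous_subspaceW _ _ _ `[a, b]).
    by apply: subset_itv; rewrite bnd_simp.
  by move=> x; apply: continuous_comp; [exact: ch|exact: norm_continuous].
rewrite in_itv/= => /andP[sx xs'] hmax.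
have : `|h x - h s'| <= L * `|h x| * (s' - x).
  apply: hL => //; first by lra.
  by move=> r /andP[xr rs']; apply: hmax; rewrite in_itv/=; apply/andP; lra.
rewrite hs'0 subr0 => hx.
have hx0 : `|h x| = 0.
  have := normr_ge0 (h x) => h0.
  have : L * `|h x| * (s' - x) <= 2^-1 * `|h x|.
    have : L * (s' - x) <= 2^-1 by apply: le_trans Ld; rewrite ler_wpM2l//; lra.
    nra.
  lra.
by apply/eqP; rewrite -normr_le0 -hx0 hmax// in_itv/= lexx.
Qed.

(** A continuity argument going backward from [b]: the a priori estimate needs
    the very bound [eta] that it improves.  At the last point where [|h|] reaches
    [eta] the estimate applies and gives a value below [eta], because
    [K * (b - a) < eta]. *)
Lemma backward_bootstrap (R : realType) (a b K eta : R) (h : R -> R) :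
  0 <= K -> {within `[a, b], continuous h} -> K * (b - a) < eta ->
  (forall s, a <= s <= b -> (forall r, s < r <= b -> `|h r| <= eta) ->
     `|h s| <= K * (b - s)) ->
  forall s, a <= s <= b -> `|h s| <= K * (b - s).
Proof.
move=> K0 ch Keta hK.
suff H s : a <= s <= b -> `|h s| < eta.
  move=> s /[dup] hs /andP[as_ sb]; apply: hK => // r /andP[sr rb].
  by apply/ltW/H/andP; lra.
move=> /andP[as_ sb]; rewrite ltNge; apply/negP => hs.
pose S := [set x | (a <= x <= b) /\ eta <= `|h x|].
have Ss : S s by split => //; apply/andP.
have Sb : ubound S b by move=> x [/andP[_]].
have supS : has_sup S by split; [exists s|exists b].
have sups : s <= sup S by apply: sup_upper_bound.
have supb : sup S <= b by apply: ge_sup; first exists s.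
have supab : a <= sup S <= b by apply/andP; lra.
have {}hK : `|h (sup S)| <= K * (b - sup S).
  apply: hK => // r /andP[sr rb]; rewrite leNgt; apply/negP => hr.
  suff : r <= sup S by rewrite leNgt sr.
  by apply: sup_upper_bound => //; split; [apply/andP; lra|exact: ltW].
have {hK} hlt : `|h (sup S)| < eta.
  apply: le_lt_trans hK _; apply: le_lt_trans Keta; rewrite ler_wpM2l//; lra.
have /subspace_continuousP/(_ (sup S)) := ch.
rewrite /= in_itv/= => /(_ supab)/cvgrPdist_lt/(_ (eta - `|h (sup S)|)).
rewrite subr_gt0 => /(_ hlt); rewrite near_withinE => /nbhs_ballP[e /= e0 he].
have [x [xab xeta] xe] := sup_adherent e0 supS.
have xS : x <= sup S by apply: sup_upper_bound.
have := he x; rewrite /ball/= in_itv/= => /(_ _ xab)/wrap[].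
  by rewrite ger0_norm; lra.
have := lerB_normD (h x) (h (sup S) - h x); rewrite [h x + _]addrC subrK.
  rewrite -[`|_ - _|]normrN opprB; lra.
Qed.

(** * Right upper limits and continuity on a set *)

Lemma limf_esup_right_le0 (R : realType) (f : R -> R) (C : R) :
  (\forall e \near 0^'+, f e <= C * e) ->
  (limf_esup (fun e => (f e)%:E) 0^'+ <= 0)%E.
Proof.
move=> fC; apply/lee_addgt0Pr => d d0; rewrite add0e limf_esupE.
apply: ge_ereal_inf.
exists (ereal_sup ((fun e => (f e)%:E) @` [set e | f e <= d])); last first.
  by apply: ge_ereal_sup => _ [e /= he <-]; rewrite lee_fin.
exists [set e | f e <= d] => //=.
near=> e; have e0 : 0 < e by near: e; exact: nbhs_right_gt.
apply: (@le_trans _ _ (C * e)); first by near: e.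
apply: (@le_trans _ _ ((`|C| + 1) * e)).
  by rewrite ler_wpM2r ?(ltW e0)// (le_trans (ler_norm _))// lerDl.
rewrite mulrC -ler_pdivlMr ?ltr_wpDl//; apply/ltW.
near: e; apply: nbhs_right_lt; rewrite divr_gt0 ?ltr_wpDl//.
Unshelve. all: by end_near. Qed.

Lemma within_continuous_powR (R : realType) (A : set R) (f : R -> R) (s : R) :
  {within A, continuous f} -> (forall x, A x -> 0 < f x) ->
  {within A, continuous (fun x => f x `^ s)}.
Proof.
move=> cf f0; rewrite continuous_subspace_in => x; rewrite inE => Ax.
apply: (@continuous_comp _ _ _ (f : subspace A -> R) (@powR R ^~ s)).
  exact: cf.
apply: differentiable_continuous; apply/derivable1_diffP.
by apply: derivable_powR; rewrite in_itv/= andbT; exact: f0.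
Qed.

Lemma within_continuous_sum (R : realType) (I : Type) (s : seq I) (A : set R)
    (f : I -> R -> R) :
  (forall i, {within A, continuous (f i)}) ->
  {within A, continuous (fun x => \sum_(i <- s) f i x)}.
Proof.
move=> cf; apply: (@continuous_big R I +%R 0 xpredT _ (subspace A)) => [|i _].
  exact: add_continuous.
exact: cf.
Qed.

Lemma within_continuousM (R : realType) (A : set R) (f g : R -> R) :
  {within A, continuous f} -> {within A, continuous g} ->
  {within A, continuous (fun x => f x * g x)}.
Proof. by move=> cf cg x; exact: (continuousM (cf x) (cg x)). Qed.

Lemma within_continuousD (R : realType) (A : set R) (f g : R -> R) :
  {within A, continuous f} -> {within A, continuous g} ->
  {within A, continuous (fun x => f x + g x)}.
Proof. by move=> cf cg x; exact: (continuousD (cf x) (cg x)). Qed.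

Lemma within_continuousB (R : realType) (A : set R) (f g : R -> R) :
  {within A, continuous f} -> {within A, continuous g} ->
  {within A, continuous (fun x => f x - g x)}.
Proof. by move=> cf cg x; exact: (continuousB (cf x) (cg x)). Qed.

Lemma within_continuous_cst (R : realType) (A : set R) (k : R) :
  {within A, continuous (fun _ : R => k)}.
Proof. by apply: continuous_subspaceT => x; exact: cst_continuous. Qed.

(** * The utility drift and its maximization *)

Section utility_ode.
Context (R : realType) (N : nat).
Context (T nu mu sigma gamma alpha : R) (rho : 'I_N -> R).
Hypotheses (halpha : 0 < alpha < 1) (hgamma1 : gamma < 1).
Implicit Types (p c : @strategy R N) (i j : 'I_N) (v : R -> R).

Local Notation drift := (utility_drift nu mu sigma gamma alpha rho).
Local Notation is_vtheta := (is_vtheta T nu mu sigma gamma alpha rho).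
Local Notation q := ((1 - gamma - alpha) / (1 - gamma)).

Definition pareto_consumption (th : 'I_N -> R) i : R :=
  (\sum_j th j) `^ (1 / (alpha - 1)) *
  th i `^ ((1 - gamma - alpha) / ((1 - alpha) * (1 - gamma))).

(** First-order condition of [c |-> alpha^-1 * th i `^ q * c `^ alpha - S * c],
    where [S] is the sum of the [th j]: raising the consumption of agent [i]
    lowers the growth rate of the common wealth, hence the weight [S]. *)
Lemma pareto_consumption_foc (th : 'I_N -> R) i : (forall j, 0 < th j) ->
  th i `^ q * pareto_consumption th i `^ (alpha - 1) = \sum_j th j.
Proof.
move=> th0; have [al0 al1] := andP halpha; have g1 := hgamma1.
have S0 : 0 < \sum_j th j.
  by rewrite (bigD1 i)//= ltr_pwDl// sumr_ge0// => j _; rewrite ltW.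
rewrite /pareto_consumption powRM ?powR_ge0// -!powRrM mulrCA -powRD; last first.
  by apply/implyP => _; rewrite gt_eqF.
have -> : 1 / (alpha - 1) * (alpha - 1) = 1.
  by rewrite mul1r mulVf//; apply/eqP; lra.
rewrite powRr1 ?ltW// (_ : _ + _ = 0) ?powRr0 ?mulr1//.
by field; apply/andP; split; apply/eqP; lra.
Qed.

(** The concave map [c |-> alpha^-1 * k * c `^ alpha] lies below its tangent at
    [a], whose slope is [S]. *)
Lemma consumption_le_tangent (k S a c : R) : 0 < a -> 0 <= c -> 0 <= k ->
  k * a `^ (alpha - 1) = S ->
  alpha^-1 * k * c `^ alpha - alpha^-1 * k * a `^ alpha <= S * (c - a).
Proof.
move=> a0 c0 k0 <-; have [al0 al1] := andP halpha.
have aE : a `^ alpha = a `^ (alpha - 1) * a.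
  rewrite -[in X in _ * X](powRr1 (ltW a0)) -powRD ?subrK//.
  by apply/implyP => _; rewrite gt_eqF.
have cE : c `^ alpha = a `^ alpha * (c / a) `^ alpha.
  by rewrite -powRM ?divr_ge0 ?(ltW a0)// mulrCA divff ?mulr1// gt_eqF.
have := @powR_le_tangent R alpha (c / a) halpha (divr_ge0 c0 (ltW a0)).
move=> /(ler_wpM2l (mulr_ge0 k0 (powR_ge0 a alpha))) h.
have -> : alpha^-1 * k * c `^ alpha - alpha^-1 * k * a `^ alpha =
    alpha^-1 * (k * a `^ alpha * ((c / a) `^ alpha) - k * a `^ alpha).
  by rewrite cE; ring.
rewrite ler_pdivrMl//.
have -> : alpha * (k * a `^ (alpha - 1) * (c - a)) =
    k * a `^ alpha * (alpha * (c / a - 1)).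
  by rewrite aE; field; rewrite gt_eqF.
lra.
Qed.

Hypotheses (hgamma0 : 0 < gamma) (hsigma : 0 < sigma).

(** The candidate strategy maximizes the total drift.  The comparison made for a
    single agent has the error term [S * (c i - cbar i) - th i * (C - Cb)], which
    has no sign but cancels in the sum over the agents. *)
Lemma utility_drift_le_pareto (th : 'I_N -> R) p c pbar cbar (r : R) :
  (forall j, 0 < th j) -> (forall j, 0 <= c j r) ->
  \sum_j pbar j r = (mu - nu) / (gamma * sigma ^+ 2) ->
  (forall j, cbar j r = pareto_consumption th j) ->
  \sum_i drift p c i r (th i) <= \sum_i drift pbar cbar i r (th i).
Proof.
move=> th0 c0 pbarE cbarE.
set S := \sum_j th j; set C := \sum_j c j r; set Cb := \sum_j cbar j r.
suff H i : drift p c i r (th i) - drift pbar cbar i r (th i) <=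
    (1 - gamma) * (S * (c i r - cbar i r) - th i * (C - Cb)).
  rewrite -subr_le0 -sumrB; apply: (le_trans (ler_sum _ (fun i _ => H i))).
  by rewrite -mulr_sumr sumrB -mulr_suml -mulr_sumr sumrB subrr mulr0.
have [al0 al1] := andP halpha.
have S0 : 0 < S.
  by rewrite /S (bigD1 i)//= ltr_pwDl// sumr_ge0// => j _; rewrite ltW.
have cb0 : 0 < cbar i r by rewrite cbarE mulr_gt0// powR_gt0.
have foc : th i `^ q * cbar i r `^ (alpha - 1) = S.
  by rewrite cbarE pareto_consumption_foc.
have hc := @consumption_le_tangent _ S (cbar i r) (c i r) cb0 (c0 i) (powR_ge0 _ _) foc.
rewrite /utility_drift pbarE -/C -/Cb.
set x := \sum_j p j r.
set G := gamma * sigma ^+ 2.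
have G0 : 0 < G by rewrite mulr_gt0// exprn_gt0.
set y := (mu - nu) / G.
have muE : mu - nu = G * y by rewrite /y mulrCA divff ?mulr1// gt_eqF.
have hp : (mu - nu) * x - G / 2 * x ^+ 2 <= (mu - nu) * y - G / 2 * y ^+ 2.
  by rewrite muE -subr_ge0; have := mulr_ge0 (ltW G0) (sqr_ge0 (x - y)); lra.
have g1 : 0 <= 1 - gamma by rewrite subr_ge0 ltW.
have /(ler_wpM2l g1) hp' := ler_wpM2l (ltW (th0 i)) hp.
have /(ler_wpM2l g1) hc' := hc.
lra.
Qed.

(** On a segment of the positive half-line the drift is bounded and Lipschitz in
    the state, with one constant for all strategies below the bound [B]: this
    uniformity is what handles all the perturbations at once. *)
Lemma utility_drift_regular (m M B : R) : 0 < m -> m <= M -> 0 <= B ->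
  exists2 K : R, 0 <= K & forall p c i (r : R),
    (forall j, 0 <= p j r <= B /\ 0 <= c j r <= B) ->
    forall u w : R, m <= u <= M -> m <= w <= M ->
    `|drift p c i r u| <= K /\
    `|drift p c i r u - drift p c i r w| <= K * `|u - w|.
Proof.
move=> m0 mM B0; have [al0 al1] := andP halpha.
have [L L0 HL] := @powR_segment_lipschitz R m M q m0.
have M0 : 0 <= M by rewrite (le_trans (ltW m0)).
have NB0 : 0 <= N%:R * B by rewrite mulr_ge0.
pose A0 : R := `|mu - nu| * (N%:R * B) + N%:R * B + `|nu| +
  `|gamma * sigma ^+ 2 / 2| * (N%:R * B) ^+ 2 + \sum_j `|rho j / alpha|.
pose D0 : R := alpha^-1 * (1 - gamma) * B `^ alpha.
have g1 : 0 < 1 - gamma by rewrite subr_gt0.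
have A00 : 0 <= A0 by rewrite !addr_ge0 ?mulr_ge0 ?sumr_ge0 ?exprn_ge0.
have D00 : 0 <= D0 by rewrite !mulr_ge0 ?powR_ge0 ?invr_ge0// ltW.
pose K1 : R := (1 - gamma) * A0 * M + D0 * (m `^ q + M `^ q).
pose K2 : R := (1 - gamma) * A0 + D0 * L.
have K10 : 0 <= K1.
  by rewrite addr_ge0 ?(mulr_ge0 (mulr_ge0 (ltW g1) A00) M0)//
    (mulr_ge0 D00)// addr_ge0 ?powR_ge0.
have K20 : 0 <= K2.
  by rewrite addr_ge0 ?(mulr_ge0 (ltW g1) A00)// (mulr_ge0 D00).
exists (K1 + K2); first exact: addr_ge0.
move=> p c i r Hpc u w hu hw.
have sum_le (x : 'I_N -> R) : (forall j, 0 <= x j <= B) ->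
    0 <= \sum_j x j <= N%:R * B.
  move=> hx; rewrite sumr_ge0/=; last by move=> j _; case/andP: (hx j).
  have -> : N%:R * B = \sum_(j < N) B.
    by rewrite sumr_const card_ord mulr_natl.
  by apply: ler_sum => j _; case/andP: (hx j).
pose A : R := (mu - nu) * (\sum_j p j r) - \sum_j c j r + nu
     - gamma * sigma ^+ 2 / 2 * (\sum_j p j r) ^+ 2 - rho i / alpha.
pose D : R := alpha^-1 * (1 - gamma) * c i r `^ alpha.
have fE z : drift p c i r z = (1 - gamma) * A * z + D * z `^ q.
  by rewrite /utility_drift -/A /D; ring.
have hA : `|A| <= A0.
  have /andP[P0 PB] := sum_le _ (fun j => (Hpc j).1).
  have /andP[C0 CB] := sum_le _ (fun j => (Hpc j).2).
  rewrite /A /A0; do !apply: (le_trans (ler_normD _ _) (lerD _ _)) => //.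
  - by rewrite normrM ler_wpM2l// ger0_norm.
  - by rewrite normrN ger0_norm.
  - by rewrite normrN normrM ler_wpM2l// ger0_norm ?exprn_ge0// lerXn2r ?nnegrE.
  - by rewrite normrN (bigD1 i)//= lerDl sumr_ge0.
have [ci0 ciB] := andP (Hpc i).2.
have hD : 0 <= D <= D0.
  rewrite /D /D0 !mulr_ge0 ?powR_ge0 ?invr_ge0 ?(ltW al0) ?(ltW g1)//=.
  by rewrite ler_wpM2l ?mulr_ge0 ?invr_ge0 ?(ltW al0) ?(ltW g1)// ge0_ler_powR ?nnegrE// ltW.
have [hD0 hD1] := andP hD.
split.
- apply: (@le_trans _ _ K1); last by rewrite lerDl.
  rewrite fE; apply: (le_trans (ler_normD _ _) (lerD _ _)).
    rewrite !normrM (ger0_norm (ltW g1)) ler_pM ?mulr_ge0 ?(ltW g1)//.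
      by rewrite ler_wpM2l// ltW.
    by rewrite ger0_norm; lra.
  rewrite normrM (ger0_norm hD0) (ger0_norm (powR_ge0 _ _)).
  by apply: ler_pM; rewrite ?powR_ge0//; exact: powR_segment_le.
- apply: (@le_trans _ _ (K2 * `|u - w|)); last first.
    by rewrite ler_wpM2r// lerDr.
  rewrite !fE; have -> : (1 - gamma) * A * u + D * u `^ q -
    ((1 - gamma) * A * w + D * w `^ q) =
    (1 - gamma) * A * (u - w) + D * (u `^ q - w `^ q) by ring.
  rewrite /K2 [X in _ <= X]mulrDl; apply: (le_trans (ler_normD _ _) (lerD _ _)).
    by rewrite !normrM (ger0_norm (ltW g1)) ler_wpM2r// ler_wpM2l// ltW.
  rewrite normrM (ger0_norm hD0) -mulrA ler_pM//; exact: HL.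
Qed.

(** * Uniqueness for the utility equation *)

Lemma admissible_ae_bound p : admissible T p ->
  exists2 B : R, 0 <= B & \forall r \ae (@lebesgue_measure R),
    0 <= r <= T -> forall j, 0 <= p j r <= B.
Proof.
move=> hp.
have /choice[B HB] : forall j, exists M, \forall s \ae (@lebesgue_measure R),
    0 <= s <= T -> p j s <= M by move=> j; case: (hp j).
exists (\sum_j `|B j|); first by rewrite sumr_ge0.
have HB' : \forall r \ae (@lebesgue_measure R),
    forall j, 0 <= r <= T -> p j r <= B j := filter_forall (lebesgue_ae_filter R) HB.
apply: filterS HB' => r Hr rT j.
have [_ /(_ _ rT) -> _] := hp j; rewrite (le_trans (Hr j rT))//=.
by rewrite (bigD1 j)//= (le_trans (ler_norm _))// lerDl sumr_ge0.
Qed.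

Lemma measurable_utility_drift p c i v : admissible T p -> admissible T c ->
  {within `[0, T], continuous v} ->
  measurable_fun `[0, T] (fun r => drift p c i r (v r)).
Proof.
move=> hp hc cv.
have mp j : measurable_fun `[0, T] (p j) by case: (hp j).
have mc j : measurable_fun `[0, T] (c j) by case: (hc j).
have mv : measurable_fun `[0, T] v.
  exact: subspace_continuous_measurable_fun.
have mP : measurable_fun `[0, T] (fun r => \sum_j p j r).
  exact: measurable_sum.
have mC : measurable_fun `[0, T] (fun r => \sum_j c j r).
  exact: measurable_sum.
have mpow (f : R -> R) s : measurable_fun `[0, T] f ->
    measurable_fun `[0, T] (fun r => f r `^ s).
  by move=> mf; apply: (measurableT_comp (measurable_powR s)).
rewrite /utility_drift; apply: measurable_funD.
  apply: measurable_funM; first exact: measurable_funM.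
  apply: measurable_funB => //; apply: measurable_funB; last first.
    by apply: measurable_funM => //; exact: measurable_funX.
  apply: measurable_funD => //; apply: measurable_funB => //.
  exact: measurable_funM.
apply: measurable_funM; last exact: mpow.
by apply: measurable_funM => //; exact: mpow.
Qed.

Lemma positive_continuous_bounds v : 0 <= T ->
  {within `[0, T], continuous v} -> (forall s : R, 0 <= s <= T -> 0 < v s) ->
  exists m M : R, [/\ 0 < m, m <= M & forall s : R, 0 <= s <= T -> m <= v s <= M].
Proof.
move=> T0 cv v0.
have [x xT hx] := EVT_min T0 cv; have [y yT hy] := EVT_max T0 cv.
rewrite !in_itv/= in xT yT.
exists (v x), (v y); split; [exact: v0|by apply: hx; rewrite in_itv|].
by move=> s sT; rewrite hx ?hy ?in_itv.
Qed.

Lemma integrable_utility_drift p c i v (a b : R) :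
  admissible T p -> admissible T c ->
  {within `[0, T], continuous v} -> (forall s : R, 0 <= s <= T -> 0 < v s) ->
  0 <= a -> b <= T ->
  (@lebesgue_measure R).-integrable `[a, b] (EFin \o (fun r => drift p c i r (v r))).
Proof.
move=> hp hc cv v0 a0 bT.
have [Tlt0|T0] := ltP T 0.
  rewrite set_itv_ge ?bnd_simp -?ltNge; first exact: integrable_set0.
  lra.
have [m [M [m0 mM hv]]] := positive_continuous_bounds T0 cv v0.
have [Bp Bp0 HBp] := admissible_ae_bound hp.
have [Bc Bc0 HBc] := admissible_ae_bound hc.
have [K K0 HK] := utility_drift_regular m0 mM (addr_ge0 Bp0 Bc0).
suff : (@lebesgue_measure R).-integrable `[0, T]
    (EFin \o (fun r => drift p c i r (v r))).
  by apply: integrableS => //; apply: subset_itv; rewrite bnd_simp.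
apply: (@ae_bounded_integrable _ _ _ K).
  exact: measurable_utility_drift.
apply: filterS2 HBp HBc => r h1 h2 rT.
have [] := HK p c i r _ (v r) (v r) (hv _ rT) (hv _ rT) => // j.
by have := h1 rT j; have := h2 rT j; lra.
Qed.

Lemma vtheta_cat p c i v (s s' : R) : admissible T p -> admissible T c ->
  is_vtheta p c i v -> 0 <= s -> s <= s' -> s' <= T ->
  v s = v s' + \int[lebesgue_measure]_(r in `[s, s']) drift p c i r (v r).
Proof.
move=> hp hc [cv v0 hv] s0 ss' s'T.
rewrite !hv; [|by apply/andP; lra|by apply/andP; lra].
rewrite (@Rintegral_itv_cat _ s s' T)//; first by ring.
exact: integrable_utility_drift.
Qed.

(** The two strategies need to agree on [[b, T]] only, as the equation is solved
    backward from [T]; both the uniqueness of the solution and the locality of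
    the perturbation are instances. *)
Lemma vtheta_unique p c p' c' i v w (b : R) :
  admissible T p -> admissible T c -> admissible T p' -> admissible T c' ->
  0 <= b <= T ->
  (forall j r, b <= r <= T -> p j r = p' j r /\ c j r = c' j r) ->
  is_vtheta p c i v -> is_vtheta p' c' i w ->
  forall s, b <= s <= T -> v s = w s.
Proof.
move=> hp hc hp' hc' /andP[b0 bT] pc hv hw.
have T0 : 0 <= T by lra.
have [cv v0 _] := hv; have [cw w0 wE] := hw.
have [m1 [M1 [m10 mM1 hv1]]] := positive_continuous_bounds T0 cv v0.
have [m2 [M2 [m20 mM2 hv2]]] := positive_continuous_bounds T0 cw w0.
have [Bp Bp0 HBp] := admissible_ae_bound hp.
have [Bc Bc0 HBc] := admissible_ae_bound hc.
have mm0 : 0 < Num.min m1 m2 by rewrite lt_min m10.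
have mMM : Num.min m1 m2 <= Num.max M1 M2.
  by rewrite ge_min; apply/orP; left; rewrite le_max mM1.
have [K K0 HK] := utility_drift_regular mm0 mMM (addr_ge0 Bp0 Bc0).
move=> s hs; apply/eqP; rewrite -subr_eq0; apply/eqP.
apply: (@gronwall_zero R b T K (fun r => v r - w r)) hs => //.
- apply: (@continuous_subspaceW _ _ _ `[0, T]).
    by apply: subset_itv; rewrite bnd_simp.
  by move=> x; apply: continuousB; [exact: cv|exact: cw].
- have [_ _ vE] := hv; rewrite vE ?wE ?lexx ?T0//.
  by rewrite set_itv1 !Rintegral_set1 subrr.
- move=> s1 s2 D bs1 s12 s2T hD.
  rewrite (@vtheta_cat p c i v s1 s2)//; last by lra.
  rewrite (@vtheta_cat p' c' i w s1 s2)//; last by lra.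
  have -> : \int[lebesgue_measure]_(r in `[s1, s2]) drift p' c' i r (w r) =
      \int[lebesgue_measure]_(r in `[s1, s2]) drift p c i r (w r).
    apply: eq_Rintegral => r; rewrite inE/= in_itv/= => /andP[s1r rs2].
    have pcr j : p j r = p' j r /\ c j r = c' j r by apply: pc; apply/andP; lra.
    rewrite /utility_drift (pcr i).2.
    by under eq_bigr do rewrite -(pcr _).1;
      under [X in _ - X + nu]eq_bigr do rewrite -(pcr _).2.
  have -> (x1 x2 y1 y2 : R) : x1 + x2 - (y1 + y2) - (x1 - y1) = x2 - y2 by ring.
  have s10 : 0 <= s1 by lra.
  have iv : (@lebesgue_measure R).-integrable `[s1, s2]
    (EFin \o (fun r => drift p c i r (v r))) by exact: integrable_utility_drift.
  have iw : (@lebesgue_measure R).-integrable `[s1, s2]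
    (EFin \o (fun r => drift p c i r (w r))) by exact: integrable_utility_drift.
  rewrite -RintegralB//.
  apply: normr_Rintegral_ae_le => //.
    exact: integrable_itvB.
  apply: filterS2 HBp HBc => r h1 h2 rs.
  have rT : 0 <= r <= T by lra.
  have hvr : Num.min m1 m2 <= v r <= Num.max M1 M2.
    by have := hv1 _ rT; rewrite ge_min le_max; move=> /andP[-> ->].
  have hwr : Num.min m1 m2 <= w r <= Num.max M1 M2.
    by have := hv2 _ rT; rewrite ge_min le_max; move=> /andP[-> ->]; rewrite !orbT.
  have [|_ hr] := HK p c i r _ (v r) (w r) hvr hwr.
    by move=> j; have := h1 rT j; have := h2 rT j; lra.
  by rewrite (le_trans hr)// ler_wpM2l// hD.
Qed.

(** * Local perturbations *)

Lemma admissible_perturb (t e : R) p c :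
  admissible T p -> admissible T c -> admissible T (perturb t e p c).
Proof.
move=> hp hc i; have [mp p0 [Mp HMp]] := hp i; have [mc c0 [Mc HMc]] := hc i.
split.
- apply: measurable_fun_if => //.
  + apply: measurable_and; first exact: measurable_fun_ler.
    exact: measurable_fun_ltr.
  + by apply: measurable_funS mp => //; exact: subIsetl.
  + by apply: measurable_funS mc => //; exact: subIsetl.
- by move=> s sT; rewrite /perturb; case: ifP => _; [exact: p0|exact: c0].
- exists (Num.max Mp Mc); apply: filterS2 HMp HMc => s h1 h2 sT.
  by rewrite /perturb le_max; case: ifP => _; rewrite ?h1 ?h2 ?orbT.
Qed.

Lemma strategies_ae_bound p c p' c' :
  admissible T p -> admissible T c -> admissible T p' -> admissible T c' ->
  exists2 B : R, 0 <= B & \forall r \ae (@lebesgue_measure R),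
    0 <= r <= T -> forall j, [/\ 0 <= p j r <= B, 0 <= c j r <= B,
                                 0 <= p' j r <= B & 0 <= c' j r <= B].
Proof.
move=> hp hc hp' hc'.
have [B1 B10 HB1] := admissible_ae_bound hp.
have [B2 B20 HB2] := admissible_ae_bound hc.
have [B3 B30 HB3] := admissible_ae_bound hp'.
have [B4 B40 HB4] := admissible_ae_bound hc'.
exists (B1 + B2 + (B3 + B4)); first by rewrite !addr_ge0.
have HB12 := @filterI _ _ (lebesgue_ae_filter R) _ _ HB1 HB2.
have HB34 := @filterI _ _ (lebesgue_ae_filter R) _ _ HB3 HB4.
apply: filterS2 HB12 HB34 => r [h1 h2] [h3 h4] rT j.
have /andP[p0 p1] := h1 rT j; have /andP[c0 c1] := h2 rT j.
have /andP[p0' p1'] := h3 rT j; have /andP[c0' c1'] := h4 rT j.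
by split; apply/andP; split => //; lra.
Qed.

(** The drift is known to be bounded only near [v b], so that [v] has to be
    confined there first, by the continuity argument. *)
Lemma vtheta_near_terminal p c i v (a b K eta : R) :
  admissible T p -> admissible T c -> is_vtheta p c i v ->
  0 <= a -> b <= T -> 0 <= K -> K * (b - a) < eta ->
  (\forall r \ae (@lebesgue_measure R), a <= r <= b ->
     forall u, `|u - v b| <= eta -> `|drift p c i r u| <= K) ->
  forall s, a <= s <= b -> `|v s - v b| <= K * (b - s).
Proof.
move=> hp hc hv a0 bT K0 Keta HK; have [cv v0 _] := hv.
apply: (@backward_bootstrap R a b K eta (fun s => v s - v b)) => //.
  apply: (@continuous_subspaceW _ _ _ `[0, T]).
    by apply: subset_itv; rewrite bnd_simp.
  by apply: within_continuousB => //; exact: within_continuous_cst.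
move=> s /andP[as_ sb] Hs; have s0 : 0 <= s := le_trans a0 as_.
rewrite (@vtheta_cat p c i v s b)// [v b + _]addrC addrK.
apply: normr_Rintegral_ae_le => //; first exact: integrable_utility_drift.
apply: filterS2 HK (lebesgue_ae_neq s) => r hr rs /andP[sr rb].
apply: hr; first by rewrite (le_trans as_).
by apply: Hs; rewrite lt_neqAle eq_sym rs sr rb.
Qed.

(** Both [v] and [th] start from the common value at [t + e] and move with speed
    at most [K], so they are [2 K e] apart, and [K]-Lipschitz continuity of the
    drift over a length [e] gives [C = 2 K ^ 2].  The remaining integral keeps
    [th] in both drifts; it has a sign only after summation over the agents. *)
Lemma perturbed_vtheta_gain p c pbar cbar i (th : R -> R) (t : R) :
  admissible T p -> admissible T c -> admissible T pbar -> admissible T cbar ->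
  is_vtheta pbar cbar i th -> 0 <= t < T ->
  exists C : R, \forall e \near 0^'+, forall v,
    is_vtheta (perturb t e p pbar) (perturb t e c cbar) i v ->
    v t - th t <= C * e ^+ 2 + \int[lebesgue_measure]_(r in `[t, t + e])
      (drift (perturb t e p pbar) (perturb t e c cbar) i r (th r)
       - drift pbar cbar i r (th r)).
Proof.
have combine (x i1 i2 i3 a : R) :
    i1 - i3 <= a -> x + i1 - (x + i2) <= a + (i3 - i2).
  by lra.
move=> hp hc hpb hcb hth /andP[t0 tT].
have T0 : 0 <= T := le_trans t0 (ltW tT).
have [cth th0 _] := hth.
have [m [M [m0 mM hm]]] := positive_continuous_bounds T0 cth th0.
have [B B0 HB] := strategies_ae_bound hp hc hpb hcb.
(* [m / 2] is a margin keeping the perturbed solution away from 0, where the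
   drift need not be Lipschitz. *)
have m20 : 0 < m / 2 by rewrite divr_gt0.
have mM2 : m / 2 <= M + m / 2 by lra.
have [K K0 HK] := utility_drift_regular m20 mM2 B0.
have ball_m (x u : R) : m <= x <= M -> `|u - x| <= m / 2 ->
    m / 2 <= u <= M + m / 2.
  by move=> hx; rewrite ler_norml; lra.
exists (2 * K ^+ 2).
near=> e => v hv.
have e0 : 0 < e by near: e; exact: nbhs_right_gt.
have eT : t + e < T.
  by rewrite -ltrBrDl; near: e; apply: nbhs_right_lt; rewrite subr_gt0.
have Ke : K * e < m / 2.
  apply: (@le_lt_trans _ _ ((K + 1) * e)).
    by rewrite ler_wpM2r ?(ltW e0)// lerDl.
  rewrite mulrC -ltr_pdivlMr ?ltr_wpDl//.
  by near: e; apply: nbhs_right_lt; rewrite divr_gt0// ltr_wpDl.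
set b := t + e in eT *.
have bte : b - t = e by rewrite /b addrC addKr.
have tb : t <= b by rewrite -subr_ge0 bte ltW.
have b0 : 0 <= b := le_trans t0 tb.
have bT : b <= T := ltW eT.
have itvT r : t <= r <= b -> 0 <= r <= T.
  by case/andP=> tr rb; rewrite (le_trans t0 tr) (le_trans rb bT).
set pe := perturb t e p pbar; set ce := perturb t e c cbar.
have hpe : admissible T pe by exact: admissible_perturb.
have hce : admissible T ce by exact: admissible_perturb.
have {}HB : \forall r \ae (@lebesgue_measure R), t <= r <= b ->
    (forall j, 0 <= pe j r <= B /\ 0 <= ce j r <= B) /\
    (forall j, 0 <= pbar j r <= B /\ 0 <= cbar j r <= B).
  apply: filterS HB => r hr /itvT rT; split=> j; have [? ? ? ?] := hr rT j => //.
  by rewrite /pe /ce /perturb; case: ifP.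
have vb : v b = th b.
  apply: (@vtheta_unique pe ce pbar cbar i v th b) => //.
  - by apply/andP.
  - move=> j r /andP[br rT]; rewrite /pe /ce /perturb.
    by rewrite ifF ?ifF//; apply/negbTE; rewrite negb_and -!leNgt br orbT.
  - by rewrite lexx.
have hmb := hm b (introT andP (conj b0 bT)).
have near_v s : t <= s <= b -> `|v s - th b| <= K * (b - s).
  rewrite -vb; apply: (vtheta_near_terminal hpe hce hv t0 bT K0 (eta := m / 2)).
    by rewrite bte.
  apply: filterS HB => r hr /hr[h1 _] u; rewrite vb => hu.
  have hu' := ball_m _ _ hmb hu.
  by have [] := HK pe ce i r h1 u u hu' hu'.
have near_th s : t <= s <= b -> `|th s - th b| <= K * (b - s).
  apply: (vtheta_near_terminal hpb hcb hth t0 bT K0 (eta := m / 2)).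
    by rewrite bte.
  apply: filterS HB => r hr /hr[_ h1] u hu.
  have hu' := ball_m _ _ hmb hu.
  by have [] := HK pbar cbar i r h1 u u hu' hu'.
have [cv v0 _] := hv.
have iev : (@lebesgue_measure R).-integrable `[t, b]
    (EFin \o (fun r => drift pe ce i r (v r))).
  exact: integrable_utility_drift.
have iet : (@lebesgue_measure R).-integrable `[t, b]
    (EFin \o (fun r => drift pe ce i r (th r))).
  exact: integrable_utility_drift.
have ibt : (@lebesgue_measure R).-integrable `[t, b]
    (EFin \o (fun r => drift pbar cbar i r (th r))).
  exact: integrable_utility_drift.
rewrite (@vtheta_cat pe ce i v t b)// (@vtheta_cat pbar cbar i th t b)// vb.
rewrite RintegralB//; apply: combine; rewrite -RintegralB//.
have -> : 2 * K ^+ 2 * e ^+ 2 = K * (K * e + K * e) * (b - t).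
  by rewrite bte; ring.
apply: Rintegral_ae_le => //; first exact: integrable_itvB.
apply: filterS HB => r hr trb; have [hre _] := hr trb.
have /andP[tr rb] := trb.
have Kbr : K * (b - r) <= K * e by rewrite -bte ler_wpM2l// lerB.
have h1 := le_trans (near_v _ trb) Kbr; have h2 := le_trans (near_th _ trb) Kbr.
have hv' := ball_m _ _ hmb (ltW (le_lt_trans h1 Ke)).
have hth' := ball_m _ _ hmb (ltW (le_lt_trans h2 Ke)).
have [_ h3] := HK pe ce i r hre (v r) (th r) hv' hth'.
apply: le_trans (ler_norm _) _; apply: (le_trans h3); rewrite ler_wpM2l//.
have -> : v r - th r = (v r - th b) - (th r - th b).
  by rewrite opprB addrA subrK.
by apply: (le_trans (ler_normB _ _)); rewrite lerD.
Unshelve. all: by end_near. Qed.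

(** Summation over the agents removes the first-order term: its integrand is
    nonpositive by maximality of the candidate. *)
Lemma perturbed_total_gain p c pbar cbar (th : 'I_N -> R -> R) (t : R) :
  admissible T p -> admissible T c -> admissible T pbar -> admissible T cbar ->
  (forall i, is_vtheta pbar cbar i (th i)) ->
  (forall t : R, 0 <= t <= T ->
     \sum_j pbar j t = (mu - nu) / (gamma * sigma ^+ 2)) ->
  (forall j (t : R), 0 <= t <= T -> cbar j t = pareto_consumption (th^~ t) j) ->
  0 <= t < T ->
  exists C : R, \forall e \near 0^'+, forall v : 'I_N -> R -> R,
    (forall i, is_vtheta (perturb t e p pbar) (perturb t e c cbar) i (v i)) ->
    \sum_i (v i t - th i t) <= C * e ^+ 2.
Proof.
move=> hp hc hpb hcb hth pbarE cbarE /[dup] tT0 /andP[t0 tT].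
have /choice[C HC] := fun i =>
  perturbed_vtheta_gain hp hc hpb hcb (hth i) tT0.
exists (\sum_i C i).
have {}HC := filter_forall (at_right_proper_filter 0) HC.
near=> e => v hv.
have e0 : 0 < e by near: e; exact: nbhs_right_gt.
have eT : t + e <= T.
  by apply: ltW; rewrite -ltrBrDl; near: e; apply: nbhs_right_lt; rewrite subr_gt0.
have HCe i : v i t - th i t <= C i * e ^+ 2 +
    \int[lebesgue_measure]_(r in `[t, t + e])
      (drift (perturb t e p pbar) (perturb t e c cbar) i r (th i r)
       - drift pbar cbar i r (th i r)).
  by move: i (v i) (hv i); near: e; exact: HC.
set pe := perturb t e p pbar in HCe; set ce := perturb t e c cbar in HCe.
have hpe : admissible T pe by exact: admissible_perturb.
have hce : admissible T ce by exact: admissible_perturb.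
have idrift i : (@lebesgue_measure R).-integrable `[t, t + e] (EFin \o
    (fun r => drift pe ce i r (th i r) - drift pbar cbar i r (th i r))).
  have [cth th0 _] := hth i.
  by apply: integrable_itvB; exact: integrable_utility_drift.
apply: (le_trans (ler_sum _ (fun i _ => HCe i))).
rewrite big_split/= -mulr_suml gerDl -Rintegral_itv_sum//.
rewrite -[X in _ <= X](mul0r (t + e - t)); apply: Rintegral_ae_le.
- by rewrite lerDl ltW.
- exact: integrable_itv_sum.
- apply: aeW => r /andP[tr re].
  have rT : 0 <= r <= T by rewrite (le_trans t0 tr) (le_trans re eT).
  rewrite sumrB subr_le0.
  apply: (@utility_drift_le_pareto (th^~ r)).
  + by move=> j; have [_ + _] := hth j; exact.
  + by move=> j; have [_ + _] := hce j; exact.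
  + exact: pbarE.
  + by move=> j; exact: cbarE.
Unshelve. all: by end_near. Qed.

(** * The candidate strategy *)

Lemma within_continuous_pareto_consumption (th : 'I_N -> R -> R) i :
  (forall j, {within `[0, T], continuous (th j)}) ->
  (forall j (t : R), 0 <= t <= T -> 0 < th j t) ->
  {within `[0, T], continuous (fun t : R => pareto_consumption (th^~ t) i)}.
Proof.
move=> cth th0; apply: within_continuousM.
- apply: within_continuous_powR.
    exact: within_continuous_sum.
  move=> y /=; rewrite in_itv/= => yT.
  by rewrite (bigD1 i)//= ltr_pwDl ?th0// sumr_ge0// => j _; rewrite ltW ?th0.
- apply: within_continuous_powR; first exact: cth.
  by move=> y /=; rewrite in_itv/= => yT; exact: th0.
Qed.

Lemma admissible_pareto_consumption (th : 'I_N -> R -> R) (cbar : strategy N) :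
  0 <= T ->
  (forall j, {within `[0, T], continuous (th j)}) ->
  (forall j (t : R), 0 <= t <= T -> 0 < th j t) ->
  (forall i (t : R), 0 <= t <= T -> cbar i t = pareto_consumption (th^~ t) i) ->
  admissible T cbar.
Proof.
move=> T0 cth th0 cbarE i.
have cc := @within_continuous_pareto_consumption th i cth th0.
split.
- apply: (eq_measurable_fun (fun t => pareto_consumption (th^~ t) i)).
    by move=> r; rewrite inE/= in_itv/= => rT; rewrite cbarE.
  exact: subspace_continuous_measurable_fun.
- by move=> s sT; rewrite cbarE// mulr_ge0 ?powR_ge0.
- have [x xT hx] := EVT_max T0 cc.
  exists (pareto_consumption (th^~ x) i); apply: aeW => s sT.
  by rewrite cbarE//; apply: hx; rewrite in_itv.
Qed.

(** Inserting the candidate strategy in the drift recovers the equation of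
    [theta], the quadratic in the investment taking its maximal value
    [(mu - nu) ^ 2 / (2 gamma sigma ^ 2)].  The fundamental theorem of calculus
    then turns the classical equation into the integrated one. *)
Lemma theta_is_vtheta (th : 'I_N -> R -> R) (pbar cbar : strategy N) i : 0 < T ->
  is_theta T nu mu sigma gamma alpha rho th ->
  (forall t : R, 0 <= t <= T -> \sum_j pbar j t = (mu - nu) / (gamma * sigma ^+ 2)) ->
  (forall j (t : R), 0 <= t <= T -> cbar j t = pareto_consumption (th^~ t) j) ->
  is_vtheta pbar cbar i (th i).
Proof.
move=> T0 [cth th0 thT dth] pbarE cbarE; split=> [//|s|s /andP[s0 sT]]; first exact: th0.
have [->|sneT] := eqVneq s T; first by rewrite set_itv1 Rintegral_set1 thT addr0.
have {sneT}{}sT : s < T by rewrite lt_neqAle sneT.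
pose y := (mu - nu) / (gamma * sigma ^+ 2).
pose C (j : 'I_N) (r : R) := pareto_consumption (th^~ r) j.
pose G r := (1 - gamma) * th i r *
    ((mu - nu) * y - \sum_j C j r + nu
     - gamma * sigma ^+ 2 / 2 * y ^+ 2 - rho i / alpha)
  + alpha^-1 * (1 - gamma) * th i r `^ q * C i r `^ alpha.
have subsT : `[s, T] `<=` `[0, T] by apply: subset_itv; rewrite bnd_simp.
have -> : \int[lebesgue_measure]_(r in `[s, T]) drift pbar cbar i r (th i r) =
    \int[lebesgue_measure]_(r in `[s, T]) G r.
  apply: eq_Rintegral => r; rewrite inE => /subsT/=; rewrite in_itv/= => rT.
  rewrite /utility_drift pbarE// cbarE// /G /y /C.
  by under eq_bigr do rewrite cbarE//.
have cC j : {within `[0, T], continuous (C j)}.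
  exact: within_continuous_pareto_consumption.
have cG : {within `[s, T], continuous G}.
  apply: continuous_subspaceW subsT _; rewrite /G.
  have cc := @within_continuous_cst R `[0, T].
  apply: within_continuousD; apply: within_continuousM.
  - exact: within_continuousM.
  - do 2 (apply: within_continuousB => //).
    apply: within_continuousD => //; apply: within_continuousB => //.
    exact: within_continuous_sum.
  - apply: within_continuousM => //; apply: within_continuous_powR => //.
    by move=> z /=; rewrite in_itv/= => zT; exact: th0.
  - apply: within_continuous_powR => // z /=; rewrite in_itv/= => zT.
    rewrite mulr_gt0// powR_gt0 ?th0//.
    by rewrite (bigD1 i)//= ltr_pwDl ?th0// sumr_ge0// => j _; rewrite ltW ?th0.
have dG : {in `]s, T[, derive1 (- th i) =1 G}.
  move=> r; rewrite in_itv/= => /andP[sr rT].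
  have r0T : 0 < r < T by apply/andP; lra.
  have [dr] := dth i r r0T.
  rewrite derive1N// => h.
  have thr j : 0 < th j r by apply: th0; apply/andP; lra.
  have [al0 al1] := andP halpha; have g0 := hgamma0; have g1 := hgamma1.
  have sg0 := hsigma; set S := \sum_j th j r in h.
  set q' := (1 - gamma - alpha) / ((1 - alpha) * (1 - gamma)) in h.
  have CE : \sum_j C j r = S `^ (1 / (alpha - 1)) * \sum_j th j r `^ q'.
    by rewrite mulr_sumr.
  have powE : th i r `^ q * C i r `^ alpha =
      th i r `^ q' * S `^ (alpha / (alpha - 1)).
    rewrite /C /pareto_consumption -/S -/q' powRM ?powR_ge0// -!powRrM mulrCA.
    rewrite -powRD; last by apply/implyP => _; rewrite gt_eqF.
    rewrite mulrC; congr (_ `^ _ * _ `^ _); last by rewrite mul1r mulrC.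
    by rewrite /q'; field; apply/andP; split; apply/eqP; lra.
  have -> : - (th i)^`()%classic r = (1 - gamma) * th i r *
      (nu + (mu - nu) ^+ 2 / (2 * gamma * sigma ^+ 2) - \sum_j C j r)
      - (1 - gamma) * rho i / alpha * th i r
      + alpha^-1 * (1 - gamma) * (th i r `^ q * C i r `^ alpha).
    by rewrite CE powE; move: h; lra.
  rewrite /G /y -[_ * th i r `^ q * _]mulrA.
  by field; do ?[apply/andP; split]; apply/eqP; lra.
have dth' : derivable_oo_LRcontinuous (- th i) s T.
  have cth' : {within `[s, T], continuous (th i)} by apply: continuous_subspaceW subsT _.
  have /(continuous_within_itvP _ sT)[_ h1 h2] := cth'.
  split; [|exact: cvgN|exact: cvgN].
  move=> r; rewrite in_itv/= => /andP[sr rT]; apply: derivableN.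
  by apply: (dth i r _).1; apply/andP; lra.
rewrite /Rintegral (continuous_FTC2 sT cG dth' dG) -EFinB/=.
have -> : (- th i) T = - th i T by [].
have -> : (- th i) s = - th i s by [].
by rewrite thT; ring.
Qed.

End utility_ode.

(** * Equilibrium *)

(** The Markovian utility and the initial wealth are both prescribed almost
    surely, and an almost sure event of a probability space is inhabited. *)
Lemma utility_value (R : realType) (d : measure_display)
    (Omega : measurableType d) (P : probability Omega R)
    (W : R -> Omega -> R) (N : nat) (T nu mu sigma gamma alpha : R)
    (rho : 'I_N -> R) (J : 'I_N -> R -> R -> strategy N -> strategy N -> R)
    (i : 'I_N) (t x : R) (p c : strategy N) :
  is_utility P W T nu mu sigma gamma alpha rho J ->
  0 <= t <= T -> 0 < x -> admissible T p -> admissible T c ->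
  exists2 v, is_vtheta T nu mu sigma gamma alpha rho p c i v &
    J i t x p c = v t / (1 - gamma) * x `^ (1 - gamma).
Proof.
move=> hJ tT x0 hp hc; have [tt TT] := andP tT.
have [X [Y [[_ _ _ Xt _] [_ [v hv Yv]] Yt]]] := hJ i t x p c tT x0 hp hc.
exists v => //.
have P0 : (0 < P setT)%E by rewrite probability_setT lte01.
have PP := ae_properfilter_algebraOfSetsType P0.
have [w [hX hY]] := filter_ex (filterI Xt Yt).
by rewrite -hY Yv ?lexx// hX.
Qed.

Theorem corollary4p6 (R : realType) (d : measure_display)
    (Omega : measurableType d) (P : probability Omega R)
    (W : R -> Omega -> R) (hW : brownian_motion P W)
    (N : nat) (hN : (1 <= N)%N)
    (T alpha sigma nu mu gamma : R) (rho : 'I_N -> R)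
    (hT : 0 < T) (halpha : 0 < alpha < 1) (hsigma : 0 < sigma) (hmu : nu < mu)
    (hgamma :
      (0 < gamma < 1 /\
       forall i, rho i <=
         alpha * (nu + (mu - nu) ^+ 2 / (2 * gamma * sigma ^+ 2))) \/
      1 - alpha <= gamma < 1)
    (J : 'I_N -> R -> R -> strategy N -> strategy N -> R)
    (hJ : is_utility P W T nu mu sigma gamma alpha rho J)
    (theta : 'I_N -> R -> R)
    (htheta : is_theta T nu mu sigma gamma alpha rho theta)
    (pbar cbar : strategy N)
    (hpbar : admissible T pbar)
    (hpbar_sum : forall t : R, 0 <= t <= T ->
      \sum_i pbar i t = (mu - nu) / (gamma * sigma ^+ 2))
    (hcbar : forall i (t : R), 0 <= t <= T ->
      cbar i t = (\sum_j theta j t) `^ (1 / (alpha - 1)) *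
        theta i t `^ ((1 - gamma - alpha) / ((1 - alpha) * (1 - gamma)))) :
  EPICS P W T nu mu sigma J pbar cbar.
Proof.
have [g0 g1] : 0 < gamma /\ gamma < 1 by case: hgamma => [[]|]; lra.
have [cth th0 _ _] := htheta.
have hcbar_adm : admissible T cbar.
  by apply: admissible_pareto_consumption cth th0 hcbar; rewrite ltW.
split=> // x0 Xbar x00 [_ _ Xpos _ _] t p c /[dup] tT0 /andP[t0 tT] hp hc.
have tT1 : 0 <= t <= T by rewrite t0 ltW.
apply: aeW => w; set x := Xbar t w.
have x_gt0 : 0 < x by exact: Xpos.
have hth i : is_vtheta T nu mu sigma gamma alpha rho pbar cbar i (theta i).
  exact: theta_is_vtheta.
have J_bar i : J i t x pbar cbar = theta i t / (1 - gamma) * x `^ (1 - gamma).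
  have [v hv ->] := utility_value i hJ tT1 x_gt0 hpbar hcbar_adm.
  congr (_ / _ * _).
  apply: (vtheta_unique halpha g1 hpbar hcbar_adm hpbar hcbar_adm tT1 _ hv (hth i)) => //.
  by rewrite lexx ltW.
have [C HC] := perturbed_total_gain halpha g1 g0 hsigma
  hp hc hpbar hcbar_adm hth hpbar_sum hcbar tT0.
(* [k] converts a gain in the solutions of the scalar equations into a gain of
   the coalition. *)
pose k := N%:R^-1 * (x `^ (1 - gamma) / (1 - gamma)).
have k0 : 0 <= k.
  by rewrite mulr_ge0 ?invr_ge0// divr_ge0 ?powR_ge0// subr_ge0 ltW.
apply: (@limf_esup_right_le0 _ _ (k * C)).
near=> e.
have e0 : 0 < e by near: e; exact: nbhs_right_gt.
have /choice[v Hv] : forall i, exists v,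
    is_vtheta T nu mu sigma gamma alpha rho
      (perturb t e p pbar) (perturb t e c cbar) i v /\
    J i t x (perturb t e p pbar) (perturb t e c cbar) =
      v t / (1 - gamma) * x `^ (1 - gamma).
  move=> i.
  have [v hv Jv] := utility_value i hJ tT1 x_gt0
    (admissible_perturb t e hp hpbar) (admissible_perturb t e hc hcbar_adm).
  by exists v.
have gain : \sum_i (v i t - theta i t) <= C * e ^+ 2.
  by move: (fun i => (Hv i).1); move: (v); near: e; exact: HC.
rewrite ler_pdivrMr// /coalition_utility -mulrBr -sumrB.
have -> : N%:R^-1 * (\sum_i (J i t x (perturb t e p pbar) (perturb t e c cbar)
    - J i t x pbar cbar)) = k * (\sum_i (v i t - theta i t)).
  rewrite /k -mulrA; congr (_ * _); rewrite mulr_sumr; apply: eq_bigr => i _.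
  by rewrite J_bar (Hv i).2; ring.
have -> : k * C * e * e = k * (C * e ^+ 2) by ring.
exact: ler_wpM2l.
Unshelve. all: by end_near. Qed.
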